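(* If a simply connected dimer model $\widetilde Q$ is weakly consistent, then it has a perfect matching.
   Context: A dimer model is a quiver with faces $Q=(Q_0,Q_1,Q_2)$, $Q_2=Q_2^{cc}\sqcup Q_2^{cl}$ a set of cycles (faces), such that every arrow lies in one face (boundary) or two faces (internal), each internal arrow lies in one face of $Q_2^{cc}$ and one of $Q_2^{cl}$, incidence graphs at vertices are connected, and every vertex has finitely many incident arrows (the model may be infinite). Gluing polygons gives a surface $S(Q)$; $Q$ is simply connected if $S(Q)$ is. For internal $\alpha$, $R_\alpha^{cc},R_\alpha^{cl}$ are the paths from $h(\alpha)$ to $t(\alpha)$ around the two faces containing $\alpha$, and $A_Q=\mathbb CQ/\langle R_\alpha^{cc}-R_\alpha^{cl}\rangle$. $Q$ is weakly consistent if $S(Q)$ is not a sphere and $Q$ is path-consistent: for all vertices $v_1,v_2$ and homotopy classes $C$ of paths from $v_1$ to $v_2$ there is a minimal path $r\in C$ (no face-path can be factored out of its class in $A_Q$), unique up to equality in $A_Q$, such that every path in $C$ equals in $A_Q$ the composition of $r$ with a unique number $m\ge0$ of face-paths (cycles going once around a face). A perfect matching of $Q$ is a set of arrows containing exactly one arrow of every face. *)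

(* Defs.v *)
From HB Require Import structures.
From Stdlib Require Import Relations.
From mathcomp Require Import all_boot all_order all_algebra.
From mathcomp Require Import generic_quotient finmap.
From mathcomp Require Import boolp classical_sets cardinality reals.
From mathcomp Require Import topology normedtype trigo.
From mathcomp Require Import complex.
(* The notations of monalg clash with those of MathComp-Analysis. *)
From mathcomp Require monalg.
Import -(notations) monalg.

Set Implicit Arguments.
Unset Strict Implicit.
Unset Printing Implicit Defensive.

Import Order.TTheory GRing.Theory Num.Theory numFieldNormedType.Exports.

Local Open Scope classical_set_scope.
Local Open Scope ring_scope.
Local Open Scope quotient_scope.

(* Faces are indexed by a type, and [boundary F] lists the arrows of the face F
   in the order in which they are travelled, from an arbitrary starting point:
   only its class up to rotation matters. *)
Record quiver_with_faces := QuiverWithFaces {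
  vertex : choiceType;
  arrow : choiceType;
  face : choiceType;
  tl : arrow -> vertex;
  hd : arrow -> vertex;
  counterclockwise : pred face;
  boundary : face -> seq arrow;
  boundary_neq0 : forall F, boundary F != [::];
  boundary_cycle : forall F, cycle (fun a b => hd a == tl b) (boundary F)
}.

Section DimerModel.
Variable Q : quiver_with_faces.

(* A side of a face is an occurrence of an arrow in its boundary, so that the
   faces containing an arrow are counted with multiplicity. *)
Definition side := {F : face Q & 'I_(size (boundary F))}.

Definition side_arrow (s : side) : arrow Q :=
  tnth (in_tuple (boundary (tag s))) (tagged s).

Definition next_side (s : side) : side :=
  existT (fun F => 'I_(size (boundary F))) (tag s) (ordS (tagged s)).

Definition boundary_arrow (a : arrow Q) :=
  exists s, forall u, side_arrow u = a <-> u = s.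

Definition internal_arrow (a : arrow Q) :=
  exists s s', s <> s' /\ forall u, side_arrow u = a <-> u = s \/ u = s'.

(* The two ends of an arrow: [(a, true)] is the end at the tail of a, and
   [(a, false)] the end at its head.  The nodes of the incidence graph at v are
   the ends lying at v, so that a loop gives two of them. *)
Definition arrow_end : Type := (arrow Q * bool)%type.

Definition end_vertex (e : arrow_end) : vertex Q :=
  if e.2 then tl e.1 else hd e.1.

Inductive incidence_edge : arrow_end -> arrow_end -> Prop :=
  IncidenceEdge s :
    incidence_edge (side_arrow s, false) (side_arrow (next_side s), true).

(* The two ends of an edge always lie at the same vertex. *)
Definition connected_incidence_graph (v : vertex Q) :=
  forall e e', end_vertex e = v -> end_vertex e' = v ->
    clos_refl_sym_trans arrow_end incidence_edge e e'.

Record is_dimer_model : Prop := {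
  dimer_one_or_two_faces : forall a, boundary_arrow a \/ internal_arrow a;
  dimer_internal : forall a, internal_arrow a ->
    (exists s, side_arrow s = a /\ counterclockwise (tag s)) /\
    (exists s, side_arrow s = a /\ ~~ counterclockwise (tag s));
  dimer_incidence : forall v, connected_incidence_graph v;
  dimer_locally_finite : forall v, finite_set [set a : arrow Q | tl a = v \/ hd a = v]
}.

Definition perfect_matching (M : set (arrow Q)) :=
  forall F, exists! a, a \in boundary F /\ M a.

Fixpoint walk (v : vertex Q) (p : seq (arrow Q)) : bool :=
  if p is a :: p' then (tl a == v) && walk (hd a) p' else true.

(* The source is recorded so that each vertex has its own trivial path. *)
Definition qpath : choiceType :=
  {p : vertex Q * seq (arrow Q) | walk p.1 p.2}.

Definition source (p : qpath) : vertex Q := (val p).1.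
Definition arrows (p : qpath) : seq (arrow Q) := (val p).2.
Definition target (p : qpath) : vertex Q := last (source p) (map (@hd Q) (arrows p)).

Lemma walk_cat v p q :
  walk v (p ++ q) = walk v p && walk (last v (map (@hd Q) p)) q.
Proof. by elim: p v => //= a p IHp v; rewrite IHp andbA. Qed.

Lemma walk_comp (p q : qpath) : target p = source q ->
  walk (source p) (arrows p ++ arrows q).
Proof.
by move=> pq; rewrite walk_cat (valP p) -/(target p) pq; apply: (valP q).
Qed.

(* Concatenation: first p, then q. *)
Definition qcomp (p q : qpath) (pq : target p = source q) : qpath :=
  exist (fun z => is_true (walk z.1 z.2)) (source p, arrows p ++ arrows q)
    (walk_comp pq).

Definition is_face_path (p : qpath) :=
  exists F i, arrows p = rot i (boundary F).

(* The path from the head to the tail of a around a face which contains a. *)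
Definition is_return_path (F : face Q) (a : arrow Q) (p : qpath) :=
  [/\ a \in boundary F, source p = hd a &
      arrows p = behead (rot (index a (boundary F)) (boundary F))].

End DimerModel.

Section DimerAlgebra.
Variables (R : realType) (Q : quiver_with_faces).

Definition path_algebra : lmodType R[i] := malg (qpath Q) R[i].

Definition path_vec (p : qpath Q) : path_algebra := mkmalgU p 1.

Definition path_vec_mul (p q : qpath Q) : path_algebra :=
  if target p =P source q is ReflectT pq then path_vec (qcomp pq) else 0.

Definition path_algebra_mul (x y : path_algebra) : path_algebra :=
  \sum_(p <- msupp x) \sum_(q <- msupp y)
    (mcoeff p x * mcoeff q y) *: path_vec_mul p q.

(* The path algebra has no unit when there are infinitely many vertices, so
   that stability under scalars is stated separately. *)
Record two_sided_ideal (I : set path_algebra) : Prop := {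
  ideal0 : I 0;
  idealD : forall x y, I x -> I y -> I (x + y);
  idealZ : forall c x, I x -> I (c *: x);
  idealMl : forall x y, I y -> I (path_algebra_mul x y);
  idealMr : forall x y, I x -> I (path_algebra_mul x y)
}.

Definition dimer_relations : set path_algebra :=
  [set x | exists a F G p q,
     [/\ internal_arrow a, counterclockwise F /\ ~~ counterclockwise G,
         is_return_path F a p, is_return_path G a q &
         x = path_vec p - path_vec q]].

(* Equality of two paths in the dimer algebra, which is the quotient of the
   path algebra by the two-sided ideal generated by the relations. *)
Definition eq_dimer_algebra (p q : qpath Q) :=
  smallest two_sided_ideal dimer_relations (path_vec p - path_vec q).

Definition minimal_path (p : qpath Q) :=
  ~ exists q F i u w, eq_dimer_algebra p q /\
      arrows q = u ++ rot i (boundary F) ++ w.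

(* p equals, in the dimer algebra, the composition of r with m face-paths. *)
Definition is_face_multiple (r : qpath Q) (m : nat) (p : qpath Q) :=
  exists (fs : seq (qpath Q)) (q : qpath Q),
    [/\ size fs = m,
        forall f, f \in fs -> is_face_path f /\ source f = target r,
        source q = source r,
        arrows q = arrows r ++ flatten (map (@arrows Q) fs) &
        eq_dimer_algebra p q].

End DimerAlgebra.

Section Homotopy.
Variables (R : realType) (T : topologicalType).

Definition unit_interval : set R := [set` `[0, 1]].

Definition path_from_to (x y : T) (f : R -> T) :=
  [/\ {within unit_interval, continuous f}, f 0 = x & f 1 = y].

(* Homotopy of paths from x to y, relative to the endpoints. *)
Definition homotopic (x y : T) (f g : R -> T) :=
  exists H : R * R -> T,
    [/\ {within unit_interval `*` unit_interval, continuous H},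
        forall t, unit_interval t -> H (0, t) = f t,
        forall t, unit_interval t -> H (1, t) = g t &
        forall s, unit_interval s -> H (s, 0) = x /\ H (s, 1) = y].

Definition simply_connected :=
  (forall x y, exists f, path_from_to x y f) /\
  (forall x y f g, path_from_to x y f -> path_from_to x y g ->
     homotopic x y f g).

Definition sphere : topologicalType :=
  set_type [set z : R * R * R | z.1.1 ^+ 2 + z.1.2 ^+ 2 + z.2 ^+ 2 = 1].

Definition is_sphere :=
  exists (f : T -> sphere) (g : sphere -> T),
    [/\ cancel f g, cancel g f, continuous f & continuous g].

End Homotopy.

Section Surface.
Variables (R : realType) (Q : quiver_with_faces).

Definition cell : choiceType := (vertex Q + arrow Q + face Q)%type.

Definition vertex_cell (v : vertex Q) : cell := inl (inl v).
Definition arrow_cell (a : arrow Q) : cell := inl (inr a).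
Definition face_cell (F : face Q) : cell := inr F.

(* A point for each vertex, a unit segment for each arrow, and a unit disk for
   each face. *)
Definition cell_region (c : cell) : set (R * R) :=
  match c with
  | inl (inl _) => [set (0, 0)]
  | inl (inr _) => [set z | 0 <= z.1 <= 1 /\ z.2 = 0]
  | inr _ => [set z | z.1 ^+ 2 + z.2 ^+ 2 <= 1]
  end.

Definition cells : topologicalType := {c : cell & set_type (cell_region c)}.

Lemma cell_origin_subproof c : (0, 0) \in cell_region c.
Proof.
apply/mem_set; case: c => [[v|a]|F] //=; first by rewrite lexx ler01.
by rewrite expr0n addr0 ler01.
Qed.

Definition cell_origin c : set_type (cell_region c) :=
  exist _ (0, 0) (cell_origin_subproof c).

(* The point of the cell c with coordinates z, meant for z in [cell_region c]. *)
Definition cell_point (c : cell) (z : R * R) : cells :=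
  existT (fun c => set_type (cell_region c)) c (insubd (cell_origin c) z).

Definition circle_point (t : R) : R * R :=
  (cos (2 * pi * t), sin (2 * pi * t)).

(* A face with n sides is a polygon whose i-th side is the arc between the
   angles 2 pi i / n and 2 pi (i + 1) / n; it is glued to the corresponding arrow
   along the direction of that arrow. *)
Inductive glued : cells -> cells -> Prop :=
| glued_tail a :
    glued (cell_point (arrow_cell a) (0, 0))
          (cell_point (vertex_cell (tl a)) (0, 0))
| glued_head a :
    glued (cell_point (arrow_cell a) (1, 0))
          (cell_point (vertex_cell (hd a)) (0, 0))
| glued_side (s : side Q) t : 0 <= t <= 1 ->
    glued (cell_point (face_cell (tag s))
             (circle_point
                (((tagged s : nat)%:R + t) / (size (boundary (tag s)))%:R)))
          (cell_point (arrow_cell (side_arrow s)) (t, 0)).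

Definition glue_rel (x y : cells) : bool :=
  `[< clos_refl_sym_trans cells glued x y >].

Lemma glue_rel_refl : reflexive glue_rel.
Proof. by move=> x; apply/asboolP; apply: rst_refl. Qed.

Lemma glue_rel_sym : symmetric glue_rel.
Proof.
by move=> x y; apply/idP/idP => /asboolP xy; apply/asboolP; apply: rst_sym.
Qed.

Lemma glue_rel_trans : transitive glue_rel.
Proof.
by move=> y x z /asboolP xy /asboolP yz; apply/asboolP; apply: rst_trans xy yz.
Qed.

Definition glue_equiv := EquivRel glue_rel glue_rel_refl glue_rel_sym glue_rel_trans.

Definition surface : topologicalType := quotient_topology {eq_quot glue_equiv}.

Definition surface_point (c : cell) (z : R * R) : surface :=
  \pi_({eq_quot glue_equiv}) (cell_point c z).

Definition vertex_point (v : vertex Q) : surface :=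
  surface_point (vertex_cell v) (0, 0).

(* The curve in the surface that travels successively along the arrows of p,
   starting from the vertex v. *)
Fixpoint trace (v : vertex Q) (p : seq (arrow Q)) (t : R) : surface :=
  if p is a :: p' then
    if t <= 2^-1 then surface_point (arrow_cell a) (2 * t, 0)
    else trace (hd a) p' (2 * t - 1)
  else vertex_point v.

(* A homotopy class of paths from v1 to v2 in the surface is given by one of
   its elements c. *)
Definition in_class (v1 v2 : vertex Q) (c : R -> surface) (p : qpath Q) :=
  [/\ source p = v1, target p = v2 &
      homotopic (vertex_point v1) (vertex_point v2)
        (trace (source p) (arrows p)) c].

Definition is_class_generator v1 v2 c (r : qpath Q) :=
  [/\ in_class v1 v2 c r, minimal_path R r &
      forall p, in_class v1 v2 c p -> exists! m, is_face_multiple R r m p].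

Definition path_consistent :=
  forall v1 v2 c, path_from_to (vertex_point v1) (vertex_point v2) c ->
    exists r, is_class_generator v1 v2 c r /\
      forall r', is_class_generator v1 v2 c r' -> eq_dimer_algebra R r' r.

Definition weakly_consistent := ~ is_sphere R surface /\ path_consistent.

End Surface.

(* Main.v *)
(* In a simply connected model all paths with the same endpoints are homotopic.
   Fix a vertex v and let r_w be the minimal path from v to w.  For an arrow a,
   let m(a) be the number with r_{t(a)} a = r_{h(a)} f^{m(a)} in the dimer
   algebra, where f^m stands for m face-paths.  Face-paths commute with arrows,
   so the number of face-paths in r_w a_1 ... a_k is the sum of the m(a_i).
   When a_1 ... a_k goes once around a face this number is 1, so exactly one of
   its arrows has m = 1: the arrows with m(a) = 1 form a perfect matching. *)
Require Import Defs.
From mathcomp Require Import all_boot all_algebra boolp classical_sets reals topology.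
From Stdlib Require Import Relations.
From mathcomp Require Import order finmap normedtype lra.
From mathcomp Require monalg.
Import -(notations) monalg.

Set Implicit Arguments.
Unset Strict Implicit.
Unset Printing Implicit Defensive.

Import Order.TTheory GRing.Theory Num.Theory numFieldNormedType.Exports.

Local Open Scope classical_set_scope.
Local Open Scope ring_scope.
Local Open Scope quotient_scope.

(** * Continuity of the curves traced by walks *)

Lemma continuous_within_comp (T U V : topologicalType) (A : set T) (B : set U)
    (g : T -> U) (f : U -> V) :
  continuous g -> (forall x, A x -> B (g x)) ->
  {within B, continuous f} -> {within A, continuous (f \o g)}.
Proof.
move=> cg gAB /subspace_continuousP cf; apply/subspace_continuousP => x Ax.
apply: cvg_trans (cf _ (gAB _ Ax)) => W /= BW.
have := cg x _ BW; rewrite /= /nbhs /=; apply: filterS => y /= + Ay.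
by apply; apply: gAB.
Qed.

Section TraceContinuity.
Variables (R : realType) (Q : quiver_with_faces).
Implicit Types (a : arrow Q) (v : vertex Q) (p : seq (arrow Q)).

(* [cell_point] sends every t outside [0, 1] to the origin; clamping t gives a
   curve which is continuous on the whole line. *)
Local Notation clamp t := (Num.min 1 (Num.max 0 t)).

Lemma clamp_region a (t : R) : cell_region (arrow_cell a) (clamp t, 0).
Proof. by split=> //=; rewrite ge_min lexx le_min ler01 le_max lexx. Qed.

Lemma arrow_continuous a :
  {within @unit_interval R,
    continuous (fun t => surface_point (arrow_cell a) (t, 0))}.
Proof.
have := @continuous_subspaceT _ _ (@unit_interval R)
  (fun t : R => surface_point (arrow_cell a) (clamp t, 0)).
have eqc : {in @unit_interval R,
    (fun t : R => surface_point (arrow_cell a) (clamp t, 0)) =1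
    (fun t : R => surface_point (arrow_cell a) (t, 0))}.
  move=> t /set_mem; rewrite /unit_interval /= in_itv /= => /andP[t0 t1].
  by rewrite (max_idPr t0) (min_idPr t1).
move=> H; apply: (subspace_eq_continuous eqc); apply: H => t.
apply: (@continuous_comp _ _ _
  (fun t : R => cell_point (arrow_cell a) (clamp t, 0))
  (\pi_(quotient_topology {eq_quot glue_equiv R Q}))); last first.
  exact: pi_continuous.
have insubd_continuous : continuous (fun t : R =>
    insubd (cell_origin R (arrow_cell a)) (clamp t, 0)
      : set_type (cell_region (arrow_cell a))).
  apply: continuous_comp_initial => u.
  rewrite (_ : _ \o _ = (fun t : R => (clamp t, 0 : R))); last first.
    apply/funext => s; rewrite [LHS]val_insubd; case: ifPn => // /negP[].
    exact/mem_set/clamp_region.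
  have cmax : {for u, continuous (fun t : R => Num.max 0 t)}.
    by apply: (@continuous_max R R); [exact: cvg_cst|exact: cvg_id].
  have cmin : {for u, continuous (fun t : R => clamp t)}.
    by apply: (@continuous_min R R); first exact: cvg_cst.
  exact: (cvg_pair cmin (cvg_cst (0 : R))).
(* [cells] carries the disjoint union topology: a neighbourhood of a point pulls back to one in the
   summand of its cell. *)
by move=> W nW; apply: (insubd_continuous t (existT _ (arrow_cell a) @^-1` W)).
Qed.

Lemma surface_point_tail a :
  surface_point (arrow_cell a) (0 : R, 0 : R) = vertex_point R (tl a).
Proof. exact/eqmodP/asboolP/rst_step/glued_tail. Qed.

Lemma surface_point_head a :
  surface_point (arrow_cell a) (1 : R, 0 : R) = vertex_point R (hd a).
Proof. exact/eqmodP/asboolP/rst_step/glued_head. Qed.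

Lemma trace0 v p : walk v p -> trace v p (0 : R) = vertex_point R v.
Proof.
case: p => //= a p /andP[/eqP <- _].
by rewrite mulr0 invr_ge0 ler0n surface_point_tail.
Qed.

Lemma trace1 v p : trace v p (1 : R) = vertex_point R (last v (map (@hd Q) p)).
Proof.
elim: p v => //= a p IHp v; rewrite invf_ge1 // leNgt ltr1n /=.
by rewrite mulr1 -[2]/(1 + 1) addrK.
Qed.

Lemma trace_consl v a p (t : R) : t <= 2^-1 ->
  trace v (a :: p) t = surface_point (arrow_cell a) (2 * t, 0).
Proof. by move=> t2 /=; rewrite t2. Qed.

(** This includes [t = 1/2], where [trace] still takes the first branch: both branches give the
    vertex [hd a] there, as the rest of the walk starts at it. *)
Lemma trace_consr v a p (t : R) : walk (hd a) p -> 2^-1 <= t ->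
  trace v (a :: p) t = trace (hd a) p (2 * t - 1).
Proof.
move=> wp; rewrite le_eqVlt => /predU1P[<-|]; last first.
  by rewrite ltNge /= => /negPf->.
have dbl2 : 2 * 2^-1 = 1 :> R by rewrite divff ?pnatr_eq0.
by rewrite trace_consl // !dbl2 subrr trace0 // surface_point_head.
Qed.

Lemma trace_continuous v p :
  walk v p -> {within @unit_interval R, continuous (@trace R Q v p)}.
Proof.
elim: p v => [v _|a p IHp v /andP[_ wp]].
  by apply: continuous_subspaceT => t; exact: cvg_cst.
(* The curve is pasted from two closed halves that overlap at [1/2]. *)
rewrite (_ : @unit_interval R =
  [set` `[0, 2^-1]] `|` [set` `[2^-1, 1]]); last first.
  apply/seteqP; split=> t; rewrite /unit_interval /= !in_itv /=.
    by move=> /andP[t0 t1]; case: (leP t 2^-1) => [|/ltW] ht; [left|right];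
      apply/andP.
  by move=> [] /andP[t0 t1]; apply/andP; split; lra.
have dbl : continuous (fun t : R => 2 * t).
  by move=> t; apply: cvgM; [exact: cvg_cst|exact: cvg_id].
apply: withinU_continuous; [exact: interval_closed|exact: interval_closed|..].
  apply: (@subspace_eq_continuous _ _ _
    ((fun t => surface_point (arrow_cell a) (t, 0)) \o (fun t : R => 2 * t))).
    move=> t /set_mem; rewrite set_itvE /= => /andP[_ t1].
    exact/esym/trace_consl.
  apply: (continuous_within_comp dbl _ (@arrow_continuous a)).
  by move=> t; rewrite /unit_interval !set_itvE /= => /andP[? ?]; lra.
apply: (@subspace_eq_continuous _ _ _
  ((trace (hd a) p) \o (fun t : R => 2 * t - 1))).
  by move=> t /set_mem; rewrite set_itvE => /andP[t1 _]; exact/esym/trace_consr.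
apply: (continuous_within_comp _ _ (IHp _ wp)).
  by move=> t; apply: cvgD; [exact: dbl|exact: cvg_cst].
by move=> t; rewrite /unit_interval !set_itvE /= => /andP[? ?]; lra.
Qed.

(** Lets simple connectedness, which speaks of curves in the surface, apply to paths of the
    quiver. *)
Lemma trace_path_from_to (p : qpath Q) :
  path_from_to (vertex_point R (source p)) (vertex_point R (target p))
    (@trace R Q (source p) (arrows p)).
Proof.
have wp := valP p : walk (source p) (arrows p).
by split; [exact: trace_continuous|exact: trace0|exact: trace1].
Qed.

End TraceContinuity.

(** * Bilinear products of formal sums *)

Section FormalSums.
Variables (K : choiceType) (S : nzRingType) (V : lmodType S).
Let U (k : K) : malg K S := mkmalgU k 1.

Lemma sum_malgU (G : K -> V) p :
  \sum_(u <- msupp (U p)) mcoeff u (U p) *: G u = G p.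
Proof. by rewrite msuppU oner_eq0 big_seq_fset1 mcoeffU eqxx scale1r. Qed.

(** Distinct basis elements have disjoint supports, so the sum has two terms, with coefficients 1
    and -1. *)
Lemma sum_malgUB (G : K -> V) p q : p != q ->
  \sum_(u <- msupp (U p - U q)) mcoeff u (U p - U q) *: G u = G p - G q.
Proof.
move=> pq.
have dpq : [disjoint msupp (U p) & msupp (U q)]%fset.
  by rewrite !msuppU oner_eq0 fdisjoint1X inE.
rewrite (msuppB dpq) !msuppU oner_eq0 big_fsetU1 ?inE //= big_seq_fset1.
rewrite !mcoeffB !mcoeffU !eqxx.
by rewrite (negPf pq) eq_sym (negPf pq) subr0 sub0r scale1r scaleN1r.
Qed.

Variable op : K -> K -> V.
(** The formula of [path_algebra_mul], for an arbitrary product [op] of basis elements. *)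
Let mul (x y : malg K S) : V := \sum_(p <- msupp x) \sum_(q <- msupp y)
  (mcoeff p x * mcoeff q y) *: op p q.

Lemma sum_malg_mulUUB u p q : p != q -> mul (U u) (U p - U q) = op u p - op u q.
Proof.
move=> pq; rewrite /mul; under eq_bigr do under eq_bigr do rewrite -scalerA.
under eq_bigr do rewrite -scaler_sumr (sum_malgUB _ pq).
exact: (sum_malgU (fun x => op x p - op x q)).
Qed.

Lemma sum_malg_mulUBU u p q : p != q -> mul (U p - U q) (U u) = op p u - op q u.
Proof.
move=> pq; rewrite /mul; under eq_bigr do under eq_bigr do rewrite -scalerA.
under eq_bigr do rewrite -scaler_sumr sum_malgU.
exact: (sum_malgUB (fun x => op x u)).
Qed.

End FormalSums.

(** * Equality in the dimer algebra as a congruence *)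

Section DimerAlgebraCongruence.
Variables (R : realType) (Q : quiver_with_faces).
Implicit Types (u v w p q : qpath Q).

Lemma path_vec_mulE p q (pq : target p = source q) :
  path_vec_mul R p q = path_vec R (qcomp pq).
Proof.
rewrite /path_vec_mul; case: eqP => [pq'|].
  by rewrite (Prop_irrelevance pq' pq).
by rewrite pq.
Qed.

(** [smallest] is an intersection: here and below, membership is checked in each two-sided ideal [I]
    containing the relations. *)
Lemma eq_dimer_refl p : eq_dimer_algebra R p p.
Proof. by move=> I [[I0 _ _ _ _] _]; rewrite subrr. Qed.

Lemma eq_dimer_sym p q : eq_dimer_algebra R p q -> eq_dimer_algebra R q p.
Proof.
move=> pq I HI; rewrite -opprB -scaleN1r; apply: (idealZ HI.1); exact: pq.
Qed.

Lemma eq_dimer_trans p q w :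
  eq_dimer_algebra R p q -> eq_dimer_algebra R q w -> eq_dimer_algebra R p w.
Proof.
move=> pq qw I HI; rewrite -(subrKA (path_vec R q)).
by apply: (idealD HI.1); [exact: pq|exact: qw].
Qed.

(** The ideal absorbs the product of [path_vec R u] with the difference of [p] and [q]. The case
    [p = q] is separate because that product is computed for distinct paths. *)
Lemma eq_dimer_compl u p q
    (up : target u = source p) (uq : target u = source q) :
  eq_dimer_algebra R p q -> eq_dimer_algebra R (qcomp up) (qcomp uq).
Proof.
have [pq|pq] := eqVneq p q.
  by subst q; rewrite (Prop_irrelevance uq up) => _; exact: eq_dimer_refl.
move=> epq I HI; have := idealMl HI.1 (path_vec R u) (epq I HI).
suff -> : path_algebra_mul (path_vec R u) (path_vec R p - path_vec R q) =
  path_vec_mul R u p - path_vec_mul R u q by rewrite !path_vec_mulE.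
exact: (sum_malg_mulUUB (@path_vec_mul R Q)).
Qed.

Lemma eq_dimer_compr u p q
    (pu : target p = source u) (qu : target q = source u) :
  eq_dimer_algebra R p q -> eq_dimer_algebra R (qcomp pu) (qcomp qu).
Proof.
have [pq|pq] := eqVneq p q.
  by subst q; rewrite (Prop_irrelevance qu pu) => _; exact: eq_dimer_refl.
move=> epq I HI; have := Defs.idealMr HI.1 (path_vec R u) (epq I HI).
suff -> : path_algebra_mul (path_vec R p - path_vec R q) (path_vec R u) =
  path_vec_mul R p u - path_vec_mul R q u by rewrite !path_vec_mulE.
exact: (sum_malg_mulUBU (@path_vec_mul R Q)).
Qed.

End DimerAlgebraCongruence.

(** * Words around faces and their rotations *)

Section Walks.
Variable Q : quiver_with_faces.
Implicit Types (a : arrow Q) (v w : vertex Q) (p q f g : seq (arrow Q)).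

Definition walk_end v p := last v (map (@hd Q) p).

Lemma walk_end_cat v p q : walk_end v (p ++ q) = walk_end (walk_end v p) q.
Proof. by rewrite /walk_end map_cat last_cat. Qed.

Lemma walkP (p : qpath Q) : walk (source p) (arrows p).
Proof. exact: valP p. Qed.

Lemma qpath_valE (p : qpath Q) v l :
  source p = v -> arrows p = l -> val p = (v, l).
Proof. by move=> <- <-; case: p => -[]. Qed.

Definition walk_path v p (wp : walk v p) : qpath Q :=
  exist (fun z => is_true (walk z.1 z.2)) (v, p) wp.

Definition face_word f := exists F i, f = rot i (boundary F).

Lemma face_word_neq0 f : face_word f -> f <> [::].
Proof.
move=> [F [i ->]] /(congr1 size); rewrite size_rot => /size0nil /eqP.
by rewrite (negPf (boundary_neq0 F)).
Qed.

Lemma path_walk a p : path (fun a b => hd a == tl b) a p = walk (hd a) p.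
Proof. by elim: p a => //= b p IHp a; rewrite eq_sym IHp. Qed.

(** [boundary_cycle] is invariant under rotation; read from [a], it says both that the word is a
    walk and that it closes up. *)
Lemma face_word_cons a f : face_word (a :: f) ->
  walk (tl a) (a :: f) /\ walk_end (tl a) (a :: f) = tl a.
Proof.
move=> [F [i E]]; have := boundary_cycle F; rewrite -(rot_cycle i) -E.
by rewrite /= rcons_path path_walk eqxx /walk_end /= last_map => /andP[-> /eqP].
Qed.

Lemma face_word_closed v f : walk v f -> face_word f -> walk_end v f = v.
Proof.
case: f => [//|a f] /= /andP[/eqP <- _] /face_word_cons[_]; exact.
Qed.

Lemma face_word_rot n f : face_word f -> face_word (rot n f).
Proof.
(* Both rotation amounts are capped at the length so that [rot_add_mod] applies. *)
move=> [F [i ->]]; exists F; rewrite rot_minn [rot i _]rot_minn.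
by rewrite rot_add_mod ?size_rot ?geq_minr //; eexists.
Qed.

Lemma face_word_rcons f a : face_word (rcons f a) -> face_word (a :: f).
Proof. by rewrite -rotr1_rcons => /face_word_rot; exact. Qed.

Lemma rcons_face_word f a : face_word (a :: f) -> face_word (rcons f a).
Proof. by rewrite -rot1_cons => /face_word_rot; exact. Qed.

Lemma face_word_side a f : face_word (a :: f) ->
  exists2 s : side Q, side_arrow s = a &
    a :: f = rot (tagged s) (boundary (tag s)).
Proof.
move=> [F [i E]].
(* A rotation by at least the length is the identity, so such an [i] is replaced by 0 to index a
   side. *)
have [j Fj] :
    exists j : 'I_(size (boundary F)), a :: f = rot j (boundary F).
  have [iF|iF] := ltnP i (size (boundary F)); first by exists (Ordinal iF).
  have F0 : (0 < size (boundary F))%N by rewrite lt0n size_eq0 boundary_neq0.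
  by exists (Ordinal F0); rewrite rot0 E rot_oversize.
exists (existT _ F j) => //.
rewrite /side_arrow (tnth_nth a) /=.
by have := congr1 (head a) Fj; rewrite /= /rot (drop_nth a) //= => <-.
Qed.

Lemma side_face_word (s : side Q) :
  exists2 f, face_word (side_arrow s :: f) &
    side_arrow s :: f = rot (tagged s) (boundary (tag s)).
Proof.
case: s => F j /=; rewrite /side_arrow /=.
set a := tnth _ _.
have E : rot j (boundary F) =
    nth a (boundary F) j :: drop j.+1 (boundary F) ++ take j (boundary F).
  by rewrite /rot (drop_nth a).
rewrite -(tnth_nth _ (in_tuple _)) in E.
eexists; last exact/esym/E.
by exists F, j.
Qed.

Lemma rot_next_side (s : side Q) :
  rot (tagged (next_side s)) (boundary (tag s)) =
  rot 1 (rot (tagged s) (boundary (tag s))).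
Proof.
case: s => F j /=; rewrite -rotS ?ltn_ord //.
(* After the last side the index wraps to 0, and rotating by the whole length is the identity. *)
have := ltn_ord j; rewrite leq_eqVlt => /predU1P[->|jF]; last first.
  by rewrite modn_small.
by rewrite modnn rot0 rot_size.
Qed.

(** The face is read from the vertex between two consecutive sides, so that one word passes through
    both nodes of an edge of the incidence graph. *)
Lemma side_face_word_rcons (s : side Q) :
  exists f, [/\ face_word f, exists g, f = rcons g (side_arrow s) &
    exists g, f = side_arrow (next_side s) :: g].
Proof.
have [f f1 fE] := side_face_word s.
have [g g1 gE] := side_face_word (next_side s).
exists (side_arrow (next_side s) :: g); split=> //; last by exists g.
exists f; rewrite gE [boundary _]/(boundary (tag s)) rot_next_side -fE.
by rewrite rot1_cons.
Qed.

End Walks.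

(** * Equality and commutation of face-paths in the dimer algebra *)

Section DimerWords.
Variables (R : realType) (Q : quiver_with_faces).
Hypothesis dimerQ : is_dimer_model Q.
Implicit Types (a : arrow Q) (v w : vertex Q) (p q f g : seq (arrow Q)).

(** The common endpoint is recorded so that both words can be extended on the right by the same
    walk. *)
Definition walk_eq v p q :=
  walk_end v p = walk_end v q /\
  exists (wp : walk v p) (wq : walk v q),
    eq_dimer_algebra R (walk_path wp) (walk_path wq).

Lemma walk_eq_walk v p q : walk_eq v p q -> walk v p /\ walk v q.
Proof. by case=> _ [wp [wq _]]. Qed.

Lemma walk_eq_refl v p : walk v p -> walk_eq v p p.
Proof. by move=> wp; split=> //; exists wp, wp; exact: eq_dimer_refl. Qed.

Lemma walk_eq_sym v p q : walk_eq v p q -> walk_eq v q p.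
Proof.
by move=> [e [wp [wq pq]]]; split=> //; exists wq, wp; exact: eq_dimer_sym.
Qed.

Lemma walk_eq_trans v p q r : walk_eq v p q -> walk_eq v q r -> walk_eq v p r.
Proof.
move=> [e [wp [wq pq]]] [e' [wq' [wr qr]]]; split; first by rewrite e.
by exists wp, wr; apply: eq_dimer_trans pq _; rewrite (Prop_irrelevance wq wq').
Qed.

Lemma eq_dimer_val (p p' q q' : qpath Q) : val p = val p' -> val q = val q' ->
  eq_dimer_algebra R p q -> eq_dimer_algebra R p' q'.
Proof. by move=> /val_inj -> /val_inj ->. Qed.

Lemma walk_eq_catl v u p q :
  walk v u -> walk_eq (walk_end v u) p q -> walk_eq v (u ++ p) (u ++ q).
Proof.
move=> wu [e [wp [wq pq]]]; split; first by rewrite !walk_end_cat e.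
have wup : walk v (u ++ p) by rewrite walk_cat wu.
have wuq : walk v (u ++ q) by rewrite walk_cat wu.
exists wup, wuq.
have := @eq_dimer_compl R Q (walk_path wu) _ _
  (erefl : target (walk_path wu) = source (walk_path wp))
  (erefl : target (walk_path wu) = source (walk_path wq)) pq.
exact: eq_dimer_val.
Qed.

Lemma walk_eq_catr v u p q :
  walk (walk_end v p) u -> walk_eq v p q -> walk_eq v (p ++ u) (q ++ u).
Proof.
move=> wu [e [wp [wq pq]]]; split; first by rewrite !walk_end_cat e.
have wpu : walk v (p ++ u) by rewrite walk_cat wp.
have wqu : walk v (q ++ u) by rewrite walk_cat wq -/(walk_end v q) -e.
exists wpu, wqu.
have := @eq_dimer_compr R Q (walk_path wu) _ _
  (erefl : target (walk_path wp) = source (walk_path wu))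
  (esym e : target (walk_path wq) = source (walk_path wu)) pq.
exact: eq_dimer_val.
Qed.

(** [t] is the first occurrence of the arrow in the face, a priori another side than [s]. *)
Lemma side_index (s : side Q) :
  exists2 t : side Q, tag t = tag s &
    side_arrow t = side_arrow s /\
    index (side_arrow s) (boundary (tag s)) = tagged t.
Proof.
case: s => F j; rewrite /side_arrow /=; set a := tnth _ _.
have aF : a \in boundary F by apply: mem_tnth.
have aF' : (index a (boundary F) < size (boundary F))%N by rewrite index_mem.
exists (existT _ F (Ordinal aF')) => //=; split=> //.
by rewrite (tnth_nth a) /= nth_index.
Qed.

(* [is_return_path] starts from the first occurrence of a.  It is the only one,
   as the other side along a lies in a face of the opposite orientation. *)
Lemma return_path_side a f (s s' : side Q) (wf : walk (hd a) f) :
  side_arrow s = a -> (forall t, side_arrow t = a -> t = s \/ t = s') ->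
  counterclockwise (tag s) != counterclockwise (tag s') ->
  a :: f = rot (tagged s) (boundary (tag s)) ->
  is_return_path (tag s) a (walk_path wf).
Proof.
move=> sa tss' cc sE; split=> //.
  by rewrite -(mem_rot (tagged s)) -sE mem_head.
have [t tt [ta]] := side_index s; rewrite sa => ->.
have [->|ts'] := tss' t (etrans ta sa); first exact: (congr1 behead sE).
by rewrite -ts' tt eqxx in cc.
Qed.

(** If both words come from the same side of [a], they coincide. Otherwise [a] is internal, its two
    sides have opposite orientations, and [f] and [g] are the two return paths of a relation. *)
Lemma face_word_behead a f g :
  face_word (a :: f) -> face_word (a :: g) -> walk_eq (hd a) f g.
Proof.
move=> fwf fwg.
have [/andP[_ wf] ef] := face_word_cons fwf.
have [/andP[_ wg] eg] := face_word_cons fwg.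
have [s sa sE] := face_word_side fwf.
have [s' sa' sE'] := face_word_side fwg.
have [ss'|/eqP ss'] := eqVneq s s'.
  subst s'; have [->] : a :: f = a :: g by rewrite sE sE'.
  exact: walk_eq_refl.
have inta : internal_arrow a.
  have [[t tP]|] := dimer_one_or_two_faces dimerQ a; last exact.
  by case: ss'; rewrite ((tP s).1 sa) ((tP s').1 sa').
have sides t : side_arrow t = a -> t = s \/ t = s'.
  have [t1 [t2 [t12 tP]]] := inta.
  move=> ta; move: ((tP t).1 ta) ((tP s).1 sa) ((tP s').1 sa').
  move=> [] -> [] es [] es'; first [by case: ss'; rewrite es es' | idtac];
    by rewrite es es'; auto.
(* The counterclockwise side [t] and the clockwise side [t'] are both among [s] and [s'], which
   forces opposite orientations. *)
have [[t [ta tcc]] [t' [ta' tcl]]] := dimer_internal dimerQ inta.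
have cc : counterclockwise (tag s) = ~~ counterclockwise (tag s').
  have [ts|ts] := sides t ta; have [ts'|ts'] := sides t' ta';
    move: tcc tcl; rewrite ts ts'.
  - by move=> ->.
  - by move=> -> ->.
  - by move=> -> /negPf ->.
  - by move=> ->.
have rs : is_return_path (tag s) a (walk_path wf).
  apply: (return_path_side (s' := s')) => //; rewrite cc.
  by case: counterclockwise.
have rs' : is_return_path (tag s') a (walk_path wg).
  apply: (return_path_side (s' := s)) => //; last first.
    by rewrite cc; case: counterclockwise.
  by move=> u /sides[]; auto.
split; first exact: (etrans ef (esym eg)).
(* A relation puts the counterclockwise return path first, so the orientation of [s] decides whether
   symmetry is used. *)
exists wf, wg; case: (boolP (counterclockwise (tag s))) => ccs.
  move=> I HI; apply: HI.2; exists a, (tag s), (tag s').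
  exists (walk_path wf), (walk_path wg).
  by split=> //; rewrite -cc.
apply: eq_dimer_sym => I HI; apply: HI.2.
exists a, (tag s'), (tag s), (walk_path wg), (walk_path wf).
by split=> //; split=> //; rewrite -[counterclockwise _]negbK -cc.
Qed.

(** Attaches face-paths to the nodes of the incidence graph: those that leave along the arrow at a
    tail end, those that come back along it at a head end. *)
Definition word_at (e : arrow_end Q) f :=
  face_word f /\ exists g, f = if e.2 then e.1 :: g else rcons g e.1.

Lemma word_at_walk e f : word_at e f -> walk (end_vertex e) f.
Proof.
case: e => a [] [fw [g E]]; move: fw; rewrite E.
  by move=> /face_word_cons[].
move=> /face_word_rcons/face_word_cons[/andP[_ wg] e].
have ge : walk_end (hd a) g = tl a by [].
have {}wg : walk (hd a) g := wg.
change (is_true (walk (hd a) (rcons g a))).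
by rewrite -cats1 walk_cat wg -/(walk_end (hd a) g) ge /= eqxx.
Qed.

(** The equality of return paths is multiplied by the arrow, on the left at a tail end and on the
    right at a head end. *)
Lemma word_at_eq e f g :
  word_at e f -> word_at e g -> walk_eq (end_vertex e) f g.
Proof.
move=> ef eg; have := word_at_walk ef.
case: e ef eg => a [] [fw [f' /= E]] [gw [g' /= E']] wf; subst f g.
  apply: (@walk_eq_catl _ [:: a]); first by rewrite /= eqxx.
  exact: face_word_behead.
rewrite -!cats1 in wf *; apply: walk_eq_catr.
  by move: wf; rewrite walk_cat => /andP[_ wa]; exact: wa.
by apply: face_word_behead; apply: face_word_rcons.
Qed.

Lemma arrow_side a : exists s : side Q, side_arrow s = a.
Proof.
have [[s sP]|[s [s' [_ sP]]]] := dimer_one_or_two_faces dimerQ a; exists s.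
  by rewrite (sP s).
by apply/(sP s); left.
Qed.

Lemma word_at_exists e : exists f, word_at e f.
Proof.
case: e => a b.
have [s sa]  := arrow_side a.
have [f fw _] := side_face_word s; rewrite sa in fw.
case: b; first by exists (a :: f); split=> //; exists f.
by exists (rcons f a); split; [exact: rcons_face_word|exists f].
Qed.

(** Across an edge, the face turning there gives a single word attached to both nodes, to which all
    others are compared. *)
Lemma word_at_connected e e' : clos_refl_sym_trans _ (@incidence_edge Q) e e' ->
  end_vertex e = end_vertex e' /\
  forall f g, word_at e f -> word_at e' g -> walk_eq (end_vertex e) f g.
Proof.
elim=> {e e'} [_ _ [s]|e|e e' _ [ee' IH]|e1 e2 e3 _ [e12 IH1] _ [e23 IH2]].
- have [h [hw hl hf]] := side_face_word_rcons s.
  have hl' : word_at (side_arrow s, false) h by [].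
  have hf' : word_at (side_arrow (next_side s), true) h by [].
  have ee' : end_vertex (side_arrow s, false) =
             end_vertex (side_arrow (next_side s), true).
    have [g E] := hf; have := word_at_walk hl'; rewrite E /=.
    by move=> /andP[/eqP].
  split=> // f g fP gP; apply: walk_eq_trans (word_at_eq fP hl') _.
  by rewrite ee'; apply: word_at_eq.
- by split=> // f g; exact: word_at_eq.
- by rewrite -ee'; split=> // f g fP gP; apply: walk_eq_sym; exact: IH.
(* Transitivity needs some word at the middle node; there is one because every arrow lies in a
   face. *)
- rewrite e12; split=> // f g fP gP; have [h hP] := word_at_exists e2.
  by apply: walk_eq_trans (IH2 _ _ hP gP); rewrite -e12; exact: IH1.
Qed.

(** The first arrows of the two words give tail ends at [v], which are linked in the connected
    incidence graph. *)
Lemma face_word_eq v f g : walk v f -> walk v g ->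
  face_word f -> face_word g -> walk_eq v f g.
Proof.
case: f => [|a f] wf wg; first by move=> /face_word_neq0.
case: g wg => [|b g] wg; first by move=> _ /face_word_neq0.
move=> fw gw; move: wf wg => /andP[/eqP av _] /andP[/eqP bv _].
have [_ H] := word_at_connected (dimer_incidence dimerQ
  (av : end_vertex (a, true) = v) (bv : end_vertex (b, true) = v)).
by rewrite -av; apply: H; split=> //; [exists f|exists g].
Qed.

(** For a face word [a h], the face-paths [f] and [a h] are equal at [tl a], so [f a = a (h a)],
    where [h a] is a face-path at [hd a]. *)
Lemma face_word_comm a f : walk (tl a) f -> face_word f ->
  exists g, [/\ face_word g, walk (hd a) g &
    walk_eq (tl a) (f ++ [:: a]) (a :: g)].
Proof.
move=> wf fw; have [s sa]  := arrow_side a.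
have [h hw _] := side_face_word s; rewrite sa in hw.
have [wh eh] := face_word_cons hw.
exists (rcons h a); split; first exact: rcons_face_word.
  have : word_at (a, false) (rcons h a).
    by split; [exact: rcons_face_word|exists h].
  exact: word_at_walk.
rewrite -cats1 -cat_cons; apply: walk_eq_catr; last exact: face_word_eq.
by rewrite (face_word_closed wf fw) /= eqxx.
Qed.

Definition face_words v (fs : seq (seq (arrow Q))) :=
  forall f, f \in fs -> face_word f /\ walk v f.

Lemma face_words_cons v f fs :
  face_words v (f :: fs) <-> [/\ face_word f, walk v f & face_words v fs].
Proof.
split=> [H|[fw wf H] g /predU1P[->//|]]; last exact: H.
have [fw wf] := H f (mem_head _ _); split=> // g gfs.
by apply: H; rewrite inE gfs orbT.
Qed.

Lemma face_words_cat v fs gs :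
  face_words v fs -> face_words v gs -> face_words v (fs ++ gs).
Proof. by move=> Hf Hg f; rewrite mem_cat => /orP[/Hf|/Hg]. Qed.

Lemma face_words_walk v fs : face_words v fs ->
  walk v (flatten fs) /\ walk_end v (flatten fs) = v.
Proof.
elim: fs => //= f fs IH /face_words_cons[fw wf /IH[w e]].
have fv := face_word_closed wf fw.
by rewrite walk_cat wf walk_end_cat -/(walk_end v f) fv.
Qed.

Lemma face_words_comm a fs : face_words (tl a) fs ->
  exists gs, [/\ size gs = size fs, face_words (hd a) gs &
    walk_eq (tl a) (flatten fs ++ [:: a]) (a :: flatten gs)].
Proof.
elim: fs => [_|f fs IH /face_words_cons[fw wf /IH[gs [sgs gsP E]]]].
  by exists [::]; split=> //; apply: walk_eq_refl; rewrite /= eqxx.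
have [g [gw wg Eg]] := face_word_comm wf fw.
have fv := face_word_closed wf fw.
exists (g :: gs); split; [by rewrite /= sgs|by apply/face_words_cons|].
rewrite /= -catA.
(* First [a] moves to the left of the other face words, then to the left of [f]. *)
apply: walk_eq_trans (_ : walk_eq _ (f ++ (a :: flatten gs)) _).
  by apply: walk_eq_catl => //; rewrite fv.
rewrite -cat_rcons -cats1 -cat_cons; apply: walk_eq_catr => //.
rewrite walk_end_cat fv; exact: (face_words_walk gsP).1.
Qed.

End DimerWords.

(** * Counting face-paths relative to minimal paths, and the matching *)

Lemma sumn_map_eq1 (T : eqType) (mu : T -> nat) (s : seq T) :
  sumn (map mu s) = 1%N -> exists! a, a \in s /\ mu a = 1%N.
Proof.
elim: s => //= a s IH; case E : (mu a) => [|[|n]] // s1.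
  have [b [[bs b1] ub]] := IH s1; exists b; split; first by rewrite inE bs orbT.
  move=> c []; rewrite inE => /predU1P[->|cs c1]; first by rewrite E.
  exact: ub.
exists a; split; first by rewrite mem_head.
move=> c []; rewrite inE => /predU1P[->//|cs] c1.
have s0 : sumn (map mu s) = 0%N by case: s1.
suff : (mu c <= 0)%N by rewrite c1.
by rewrite -s0 sumnE big_map (big_rem c) //= leq_addr.
Qed.

Section Matching.
Variables (R : realType) (Q : quiver_with_faces).
Hypothesis dimerQ : is_dimer_model Q.
Variables (v : vertex Q) (r : vertex Q -> qpath Q).
Hypothesis sourceE : forall w, source (r w) = v.
Hypothesis targetE : forall w, target (r w) = w.
Implicit Types (a : arrow Q) (w : vertex Q) (p q : seq (arrow Q)).

Definition winding w m p := exists fs,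
  [/\ size fs = m, face_words w fs &
    walk_eq R v p (arrows (r w) ++ flatten fs)].

Lemma walk_generator w : walk v (arrows (r w)).
Proof. by rewrite -(sourceE w); exact: walkP. Qed.

Lemma walk_end_generator w : walk_end v (arrows (r w)) = w.
Proof. by rewrite -[RHS]targetE /target sourceE. Qed.

(** Passes from bundled face-paths to plain words, on which the commutation lemmas work. *)
Lemma is_face_multipleP (p : qpath Q) w m : source p = v -> target p = w ->
  is_face_multiple R (r w) m p <-> winding w m (arrows p).
Proof.
move=> sp tp; split.
  move=> [fs [q [sfs fsP sq aq pq]]]; exists (map (@arrows Q) fs).
  have fsw : face_words w (map (@arrows Q) fs).
    move=> _ /mapP[f /fsP[ff sf] ->]; split=> //.
    by rewrite -(targetE w) -sf; exact: walkP.
  split=> //; first by rewrite size_map.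
  have wp : walk v (arrows p) by rewrite -sp; exact: walkP.
  have wq : walk v (arrows (r w) ++ flatten (map (@arrows Q) fs)).
    by rewrite -aq -(sourceE w) -sq; exact: walkP.
  split.
    rewrite walk_end_cat walk_end_generator (face_words_walk fsw).2.
    by rewrite -[RHS]tp /target sp.
  exists wp, wq; apply: eq_dimer_val pq.
    exact: qpath_valE.
  by apply: qpath_valE => //; rewrite sq.
move=> [fs [sfs fsw [_ [wp [wq pq]]]]].
(* The default value [r w] is never taken, as each [f] is a walk from [w]. *)
have fE f : f \in fs -> val (insubd (r w) (w, f)) = (w, f).
  by move=> /fsw[_ wf]; rewrite insubdK.
exists (map (fun f => insubd (r w) (w, f)) fs), (walk_path wq); split.
- by rewrite size_map.
- move=> _ /mapP[f ffs ->]; rewrite /is_face_path /source /arrows fE //.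
  by split; [exact: (fsw f ffs).1|rewrite targetE].
- by rewrite sourceE.
- congr (_ ++ flatten _); rewrite -map_comp -[LHS]map_id.
  by apply/eq_in_map => f ffs; rewrite /= /arrows fE.
- by apply: eq_dimer_val pq => //; apply/esym/qpath_valE.
Qed.

Hypothesis generates : forall w (p : qpath Q), source p = v -> target p = w ->
  exists! m, is_face_multiple R (r w) m p.

Lemma winding_exists p : walk v p -> exists m, winding (walk_end v p) m p.
Proof.
move=> wp; have [m [+ _]] := @generates _ (walk_path wp) erefl erefl.
by move=> /is_face_multipleP H; exists m; exact: H.
Qed.

Lemma winding_unique w m n p : winding w m p -> winding w n p -> m = n.
Proof.
move=> pm pn; have [fs [_ fsw pE]] := pm.
have [wp _] := walk_eq_walk pE.
have tp : target (walk_path wp) = w.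
  have := pE.1.
  by rewrite walk_end_cat walk_end_generator (face_words_walk fsw).2; exact.
have [k [_ uk]] := @generates _ (walk_path wp) erefl tp.
have := uk m; have := uk n; rewrite !is_face_multipleP //.
by move=> <- // <-.
Qed.

(** With [t = tl a] and [h = hd a]: [p a = r_t f^m a = r_t a f^m = r_h f^n f^m]. The lists [hs] and
    [gs] hold the [m] and [n] face-paths at [h]. *)
Lemma winding_rcons a m n p :
  winding (tl a) m p -> winding (hd a) n (rcons (arrows (r (tl a))) a) ->
  winding (hd a) (n + m) (rcons p a).
Proof.
move=> [fs [sfs fsw pE]] [gs [sgs gsw aE]].
have [hs [shs hsw hE]] := face_words_comm R dimerQ fsw.
exists (gs ++ hs).
split; [by rewrite size_cat sgs shs sfs|exact: face_words_cat|].
rewrite -cats1.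
apply: walk_eq_trans (walk_eq_catr _ pE) _.
  rewrite pE.1 walk_end_cat walk_end_generator (face_words_walk fsw).2.
  by rewrite /= eqxx.
rewrite -catA; apply: walk_eq_trans (walk_eq_catl (walk_generator _) _) _.
  by rewrite walk_end_generator; exact: hE.
rewrite flatten_cat catA -cat_rcons; apply: walk_eq_catr aE.
rewrite -cats1 walk_end_cat; exact: (face_words_walk hsw).1.
Qed.

Lemma winding_arrows (mu : arrow Q -> nat) :
  (forall a, winding (hd a) (mu a) (rcons (arrows (r (tl a))) a)) ->
  forall q w m p, winding w m p -> walk w q ->
  winding (walk_end w q) (sumn (map mu q) + m) (p ++ q).
Proof.
move=> muP; elim=> [|a q IH] w m p wp; first by rewrite cats0.
move=> /= /andP[/eqP aw wq]; rewrite -cat_rcons -addnA addnCA.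
by apply: (IH (hd a)) wq; apply: winding_rcons (muP a); rewrite aw.
Qed.

Lemma exists_perfect_matching : exists M : set (arrow Q), perfect_matching M.
Proof.
have muE a : exists m, winding (hd a) m (rcons (arrows (r (tl a))) a).
  have wa : walk v (rcons (arrows (r (tl a))) a).
    rewrite -cats1 walk_cat walk_generator -/(walk_end _ _) walk_end_generator.
    by rewrite /= eqxx.
  have := winding_exists wa; congr (exists m, winding _ m _).
  by rewrite -cats1 walk_end_cat.
have [mu muP] := choice muE.
exists [set a | mu a = 1%N] => F; apply: sumn_map_eq1.
have [a [f E]] : exists a f, boundary F = a :: f.
  by have := boundary_neq0 F; case: boundary => // a f _; exists a, f.
have fw : face_word (boundary F) by exists F, 0%N; rewrite rot0.
have [wf ef] : walk (tl a) (boundary F) /\ walk_end (tl a) (boundary F) = tl a.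
  by rewrite E in fw *; exact: face_word_cons.
have w0 : winding (tl a) 0 (arrows (r (tl a))).
  by exists [::]; split=> //; rewrite cats0; apply/walk_eq_refl/walk_generator.
(* The minimal path followed by the boundary of [F] is counted twice: arrow by arrow it gives the
   sum of [mu], as one face-path it gives 1. *)
have := winding_arrows muP w0 wf; rewrite ef addn0 => /winding_unique; apply.
exists [:: boundary F]; split=> //.
  by move=> f'; rewrite inE => /eqP ->.
rewrite /= cats0; apply: walk_eq_refl.
by rewrite walk_cat walk_generator -/(walk_end _ _) walk_end_generator.
Qed.

End Matching.

Theorem theorem6p7 (R : realType) (Q : quiver_with_faces) :
  is_dimer_model Q ->
  simply_connected R (surface R Q) ->
  weakly_consistent R Q ->
  exists M : set (arrow Q), perfect_matching M.
Proof.
move=> dimerQ [connected homotopy] [_ consistent].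
(* Without vertices there are no arrows, hence no faces, since boundaries are nonempty; the empty
   set then works. *)
have [[v]|noV] := pselect (inhabited (vertex Q)); last first.
  exists set0 => F; have := boundary_neq0 F; case: boundary => // a f _.
  by case: noV; split; exact: (tl a).
have [c cP] := choice (connected (vertex_point R v)).
have [r rP] := choice (fun w => consistent v w _ (cP (vertex_point R w))).
apply: (@exists_perfect_matching R Q dimerQ v r) => [w|w|w p sp tp].
- by have [[[]]] := rP w.
- by have [[[]]] := rP w.
(* By simple connectedness every path from [v] to [w] lies in the class of the chosen curve to
   [w]. *)
have [[_ _ gen] _] := rP w; apply: gen; split=> //.
apply: homotopy; last exact: cP.
by rewrite -sp -tp; exact: trace_path_from_to.
Qed.
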